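(* Let $R$ be a commutative ring and let $E$ be a subset of $\operatorname{Spec}(R)$. Consider the patch topology on $\operatorname{Spec}(R)$, and consider the canonical ring map $\pi: R\rightarrow\prod_{\mathfrak{p}\in E}\kappa(\mathfrak{p})$, where $\kappa(\mathfrak{p})$ is the residue field of $R$ at $\mathfrak{p}$. Then $\operatorname{cl}(E)=\operatorname{Im}\pi^{\ast}$, where $\operatorname{cl}(E)$ denotes the closure of $E$ in $\operatorname{Spec}(R)$ with respect to the patch topology.
   Context: All rings are commutative (with identity). For a ring $R$ and $f\in R$, put $V(f)=\{\mathfrak{p}\in\operatorname{Spec}(R): f\in\mathfrak{p}\}$ and $D(f)=\operatorname{Spec}(R)\setminus V(f)$. The patch (or constructible) topology on $\operatorname{Spec}(R)$ is the topology having the collection of subsets $D(f)\cap V(g)$, with $f,g\in R$, as a sub-basis of opens. A ring map $\phi:A\rightarrow B$ induces the map $\phi^{\ast}:\operatorname{Spec}(B)\rightarrow\operatorname{Spec}(A)$, $\mathfrak{p}\mapsto\phi^{-1}(\mathfrak{p})$. *)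

(* Defs.v *)
From HB Require Import structures.
From mathcomp Require Import all_boot all_algebra.
From mathcomp Require Import all_classical topology.

Set Implicit Arguments.
Unset Strict Implicit.
Unset Printing Implicit Defensive.

Import GRing.Theory.
Local Open Scope classical_set_scope.
Local Open Scope ring_scope.

(* Rings are comPzRingType, so that the zero ring (with empty spectrum) is
   allowed; it occurs below as the product over an empty family. *)

Record prime_ideal (R : comPzRingType) (P : set R) : Prop := PrimeIdeal {
  prime_ideal0 : P 0;
  prime_idealD : forall a b, P a -> P b -> P (a + b);
  prime_idealMl : forall a b, P b -> P (a * b);
  prime_ideal1 : ~ P 1;
  prime_ideal_prime : forall a b, P (a * b) -> P a \/ P b }.

Record Spec (R : comPzRingType) : Type := MkSpec {
  Spec_set : set R;
  Spec_prime : prime_ideal Spec_set }.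

HB.instance Definition _ (R : comPzRingType) := gen_eqMixin (Spec R).
HB.instance Definition _ (R : comPzRingType) := gen_choiceMixin (Spec R).

Definition Spec_V (R : comPzRingType) (f : R) : set (Spec R) :=
  [set p : Spec R | Spec_set p f].
Definition Spec_D (R : comPzRingType) (f : R) : set (Spec R) := ~` Spec_V f.

Definition patch_subbase (R : comPzRingType) : set (set (Spec R)) :=
  [set U | exists f g : R, U = Spec_D f `&` Spec_V g].

(* Spec R itself carries no topology; its alias PatchSpec R carries the patch
   topology. *)
Definition PatchSpec (R : comPzRingType) : Type := Spec R.

HB.instance Definition _ (R : comPzRingType) := Choice.on (PatchSpec R).
HB.instance Definition _ (R : comPzRingType) :=
  isSubBaseTopological.Build (PatchSpec R) (@patch_subbase R) id.

Section SpecMap.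
Variables (A B : comPzRingType) (phi : {rmorphism A -> B}).

Lemma prime_ideal_preimage (q : Spec B) : prime_ideal (phi @^-1` Spec_set q).
Proof.
have [q0 qD qM q1 qP] := Spec_prime q; split=> /=.
- by rewrite rmorph0.
- by move=> a b qa qb; rewrite rmorphD; exact: qD.
- by move=> a b qb; rewrite rmorphM; exact: qM.
- by rewrite rmorph1.
- by move=> a b; rewrite rmorphM; exact: qP.
Qed.

Definition Spec_map (q : Spec B) : Spec A := MkSpec (prime_ideal_preimage q).

End SpecMap.

Section ResidueField.
Variables (R : comPzRingType) (p : Spec R).

(* The quotients of ring_quotient.v are only available over nonzero rings.
   The ring R is nonzero as soon as it has a prime ideal p, so this alias of R
   can be given the required structure. *)
Definition base_ring (q : Spec R) : Type := R.

HB.instance Definition _ (q : Spec R) := GRing.ComPzRing.on (base_ring q).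

Lemma base_ring_oner_neq0 (q : Spec R) : 1 != 0 :> base_ring q.
Proof.
apply/eqP => e; apply: (prime_ideal1 (Spec_prime q)).
by rewrite [X in _ X]e; exact: prime_ideal0 (Spec_prime q).
Qed.

HB.instance Definition _ (q : Spec R) :=
  GRing.PzSemiRing_isNonZero.Build (base_ring q) (@base_ring_oner_neq0 q).

Definition prime_pred : base_ring p -> bool := fun a => `[< Spec_set p a >].

Lemma prime_pred_idealr_closed : idealr_closed (prime_pred : {pred base_ring p}).
Proof.
have [p0 pD pM p1 _] := Spec_prime p.
split; rewrite ?unfold_in; first exact/asboolP.
  by apply/asboolP.
move=> a u v; rewrite !unfold_in => /asboolP pu /asboolP pv.
by apply/asboolP; apply: pD => //; exact: pM.
Qed.

HB.instance Definition _ :=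
  isIdealr.Build (base_ring p) prime_pred prime_pred_idealr_closed.

Lemma prime_pred_prime : prime_idealr_closed (prime_pred : {pred base_ring p}).
Proof.
move=> u v; rewrite !unfold_in => /asboolP /(prime_ideal_prime (Spec_prime p)).
by move=> [pu|pv]; apply/orP; [left|right]; apply/asboolP.
Qed.

HB.instance Definition _ :=
  isPrimeIdealrClosed.Build (base_ring p) prime_pred prime_pred_prime.

Definition prime_pidealr : prime_idealr (base_ring p) := prime_pred.

Definition residue_domain : Type := {ideal_quot prime_pidealr}.

HB.instance Definition _ := GRing.ComNzRing.on residue_domain.

Definition residue_domain_unit : {pred residue_domain} :=
  fun x => `[< exists y, y * x = 1 >].
Definition residue_domain_inv (x : residue_domain) : residue_domain :=
  if pselect (exists y, y * x = 1) is left ex then projT1 (cid ex) else x.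

Fact residue_domain_mulVx :
  {in residue_domain_unit, left_inverse 1 residue_domain_inv *%R}.
Proof.
move=> x; rewrite unfold_in => /asboolP ex; rewrite /residue_domain_inv.
by case: pselect => // e; case: cid.
Qed.

Fact residue_domain_unitPl (x y : residue_domain) :
  y * x = 1 -> residue_domain_unit x.
Proof. by move=> xy; apply/asboolP; exists y. Qed.

Fact residue_domain_inv_out :
  {in [predC residue_domain_unit], residue_domain_inv =1 id}.
Proof.
move=> x; rewrite inE => /negP nx; rewrite /residue_domain_inv.
by case: pselect => // e; exfalso; apply: nx; apply/asboolP.
Qed.

HB.instance Definition _ := GRing.ComNzRing_hasMulInverse.Build residue_domain
  residue_domain_mulVx residue_domain_unitPl residue_domain_inv_out.

HB.instance Definition _ := GRing.ComUnitRing_isIntegral.Build residue_domain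
  (@Quotient.rquot_IdomainAxiom (base_ring p) prime_pidealr).

(* kappa(p) as the field of fractions of R/p *)
Definition residue_field : fieldType := {fraction residue_domain}.

Definition residue_map (a : R) : residue_field :=
  FracField.tofrac (\pi_{ideal_quot prime_pidealr}%qT (a : base_ring p) : residue_domain).

Fact residue_map_is_zmod_morphism : zmod_morphism residue_map.
Proof.
move=> a b; rewrite /residue_map -tofracB; congr FracField.tofrac.
exact: (raddfB (\pi_{ideal_quot prime_pidealr}%qT)).
Qed.

Fact residue_map_is_monoid_morphism : monoid_morphism residue_map.
Proof.
split=> [|a b]; rewrite /residue_map -?tofrac1 -?tofracM;
  congr FracField.tofrac.
  exact: (rmorph1 (\pi_{ideal_quot prime_pidealr}%qT)).
exact: (rmorphM (\pi_{ideal_quot prime_pidealr}%qT)).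
Qed.

HB.instance Definition _ := GRing.isZmodMorphism.Build R residue_field
  residue_map residue_map_is_zmod_morphism.
HB.instance Definition _ := GRing.isMonoidMorphism.Build R residue_field
  residue_map residue_map_is_monoid_morphism.

End ResidueField.

Definition ring_prod (I : Type) (K : I -> comPzRingType) : Type := forall i, K i.

Section RingProd.
Variables (I : Type) (K : I -> comPzRingType).
Local Notation prodK := (ring_prod K).
Implicit Types x y z : prodK.

HB.instance Definition _ := Choice.copy prodK (forall i, K i).

Definition ring_prod_zero : prodK := fun=> 0.
Definition ring_prod_one : prodK := fun=> 1.
Definition ring_prod_opp x : prodK := fun i => - x i.
Definition ring_prod_add x y : prodK := fun i => x i + y i.
Definition ring_prod_mul x y : prodK := fun i => x i * y i.

Fact ring_prod_addA : associative ring_prod_add.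
Proof. by move=> x y z; apply: functional_extensionality_dep => i; exact: addrA. Qed.
Fact ring_prod_addC : commutative ring_prod_add.
Proof. by move=> x y; apply: functional_extensionality_dep => i; exact: addrC. Qed.
Fact ring_prod_add0 : left_id ring_prod_zero ring_prod_add.
Proof. by move=> x; apply: functional_extensionality_dep => i; exact: add0r. Qed.
Fact ring_prod_addN : left_inverse ring_prod_zero ring_prod_opp ring_prod_add.
Proof. by move=> x; apply: functional_extensionality_dep => i; exact: addNr. Qed.

HB.instance Definition _ := GRing.isZmodule.Build prodK
  ring_prod_addA ring_prod_addC ring_prod_add0 ring_prod_addN.

Fact ring_prod_mulA : associative ring_prod_mul.
Proof. by move=> x y z; apply: functional_extensionality_dep => i; exact: mulrA. Qed.
Fact ring_prod_mulC : commutative ring_prod_mul.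
Proof. by move=> x y; apply: functional_extensionality_dep => i; exact: mulrC. Qed.
Fact ring_prod_mul1 : left_id ring_prod_one ring_prod_mul.
Proof. by move=> x; apply: functional_extensionality_dep => i; exact: mul1r. Qed.
Fact ring_prod_mulDl : left_distributive ring_prod_mul ring_prod_add.
Proof. by move=> x y z; apply: functional_extensionality_dep => i; exact: mulrDl. Qed.

HB.instance Definition _ := GRing.Zmodule_isComPzRing.Build prodK
  ring_prod_mulA ring_prod_mulC ring_prod_mul1 ring_prod_mulDl.

End RingProd.

Section CanonicalMap.
Variables (R : comPzRingType) (E : set (Spec R)).

(* E is coerced to the type of its elements. *)
Definition residue_prod : comPzRingType :=
  ring_prod (fun p : E => residue_field (\val p) : comPzRingType).

Definition residue_prod_map (a : R) : residue_prod :=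
  fun p : E => residue_map (\val p) a.

Fact residue_prod_map_is_zmod_morphism : zmod_morphism residue_prod_map.
Proof.
by move=> a b; apply: functional_extensionality_dep => p; exact: rmorphB.
Qed.

Fact residue_prod_map_is_monoid_morphism : monoid_morphism residue_prod_map.
Proof.
split=> [|a b]; apply: functional_extensionality_dep => p; first exact: rmorph1.
exact: rmorphM.
Qed.

HB.instance Definition _ := GRing.isZmodMorphism.Build R residue_prod
  residue_prod_map residue_prod_map_is_zmod_morphism.
HB.instance Definition _ := GRing.isMonoidMorphism.Build R residue_prod
  residue_prod_map residue_prod_map_is_monoid_morphism.

End CanonicalMap.

(* Main.v *)
Require Import Defs.
From mathcomp Require Import all_boot all_algebra.
From mathcomp Require Import finmap all_classical topology.

(** The proof identifies prime ideals of a product of fields with ultrafilters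
    on the index set.  The zero sets of the elements of a prime ideal [q] form
    a proper filter [zero_filter q]; conversely, for an ultrafilter [G] on the
    index set, the elements whose zero set lies in [G] form a prime ideal
    [ultra_ideal G].

    In the patch topology all the sets [V(f)] and [D(f)] are open, and a filter
    [F] converges to [p] exactly when, for each [f], it contains the one of
    [V(f)] and [D(f)] that contains [p] ([cvg_patchP]).  Take the index set
    [E], and the product of the residue fields [kappa(e)].  The zero set of
    [pi f] is the trace of [V(f)] on [E], since [f] vanishes in [kappa(e)]
    exactly when [f] lies in [e] ([residue_map_eq0]).  So, for corresponding
    [G] and [q], the assertion that [G] converges to [p] and the assertion that
    [q] contracts to [p] both say that [f] is in [p] if and only if the trace
    of [V(f)] belongs to [G].  The closure of [E] consists of the limits of
    proper filters on [E] ([closure_set_typeP]), and such a filter may be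
    enlarged to an ultrafilter without losing its limits. *)

Set Implicit Arguments.
Unset Strict Implicit.
Unset Printing Implicit Defensive.

Import GRing.Theory.
Local Open Scope classical_set_scope.
Local Open Scope ring_scope.

(** The filter on [E] that witnesses a point [p] of the closure is the trace of
    the neighbourhoods of [p].  Filters on the subtype, rather than filters on
    [T] containing [E], are used because the product of the residue fields is
    indexed by the subtype. *)
Lemma closure_set_typeP (T : topologicalType) (E : set T) (p : T) :
  closure E p <->
  exists2 G : set_system E, ProperFilter G & (\val : E -> T) @ G --> p.
Proof.
split=> [clEp|[G PG Gp] B /Gp GB]; last first.
  by have [e Be] := filter_ex (GB : G (\val @^-1` B));
  exists (\val e); split=> //; exact: set_valP.
exists (filter_from (nbhs p) (fun B => (\val : E -> T) @^-1` B)).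
  apply: filter_from_proper => [|B /clEp[x [Ex Bx]]]; last first.
    by exists (SigSub (mem_set Ex)).
  apply: filter_from_filter => [|B C pB pC].
    by exists setT; exact: filterT.
  by exists (B `&` C) => //; exact: filterI.
by move=> B pB; exists B.
Qed.

Section PatchTopology.
Variables (R : comPzRingType) (p : Spec R).

Lemma nbhs_patch (U : set (Spec R)) :
  patch_subbase U -> U p -> nbhs (p : PatchSpec R) U.
Proof.
move=> sU Up; rewrite nbhsE; exists U => //; split=> //.
exists [set U]; last by rewrite bigcup_set1.
move=> _ ->; exists [fset U]%fset; first move=> V.
  by rewrite in_fset1 inE => /eqP->.
rewrite predeqE => x; split=> [|Ux V]; first by apply; rewrite /= inE.
by rewrite /= inE => /eqP->.
Qed.

Lemma cvg_patchP (F : set_system (PatchSpec R)) : Filter F ->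
  F --> (p : PatchSpec R) <->
  forall f, (Spec_V f p -> F (Spec_V f)) /\ (Spec_D f p -> F (Spec_D f)).
Proof.
move=> FF; split=> [Fp f|FVD].
  (* D(1) and V(0) are the whole spectrum, so the subbase contains all V(f)
     and all D(f). *)
  have D1 : Spec_D (1 : R) = setT.
    by apply/seteqP; split=> // q _; exact: prime_ideal1 (Spec_prime q).
  have V0 : Spec_V (0 : R) = setT.
    by apply/seteqP; split=> // q _; exact: prime_ideal0 (Spec_prime q).
  split=> pf; apply/Fp/nbhs_patch => //.
    by exists 1, f; rewrite D1 setTI.
  by exists f, 0; rewrite V0 setIT.
move=> A; rewrite /= (@nbhsE (PatchSpec R)).
move=> [_ [[B sB <-] [C BC Cp] sUBA]].
rewrite nbhs_filterE; apply: filterS sUBA _.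
apply: (@filterS _ _ _ C) => [x Cx|]; first by exists C.
have /sB [D sD IDeC] := BC; rewrite -IDeC; apply: filter_bigI => U DU.
have := sD _ DU; rewrite inE => -[f [g Ufg]].
have : U p by move: Cp; rewrite -IDeC => /(_ _ DU).
rewrite Ufg => -[Df Vg].
by apply: filterI; [exact: (FVD f).2|exact: (FVD g).1].
Qed.

End PatchTopology.

Section ProductOfFields.
Variables (I : Type) (K : I -> fieldType).
Local Notation prodK := (ring_prod (fun i => K i : comPzRingType)).
Implicit Types (x y : prodK) (q : Spec prodK) (G : set_system I).

Definition zeros x : set I := [set i | x i = 0].

Definition zero_filter q : set_system I := filter_from (Spec_set q) zeros.

(** An element with empty zero set is a unit, so the filter is proper.  It is
    closed under intersection because any two elements [x] and [y] have a linear
    combination vanishing exactly on [zeros x `&` zeros y]. *)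
Lemma zero_filter_proper q : ProperFilter (zero_filter q).
Proof.
have [q0 qD qM q1 qP] := Spec_prime q.
apply: filter_from_proper => [|x qx].
  apply: filter_from_filter => [|x y qx qy]; first by exists 0.
  (* the coefficient of [y] is the indicator function of [zeros x] *)
  pose e : prodK := fun i => 1 - (x i)^-1 * x i.
  exists (x + e * y); first by apply: qD => //; exact: qM.
  move=> i; suff: x i + e i * y i = 0 -> x i = 0 /\ y i = 0 by [].
  rewrite /e; have [->|xi0] := eqVneq (x i) 0.
    by rewrite mulr0 subr0 mul1r add0r.
  by rewrite mulVf // subrr mul0r addr0 => /eqP; rewrite (negPf xi0).
have [//|/forallNP Zx0] := pselect (zeros x !=set0).
exfalso; apply: q1; pose v : prodK := fun i => (x i)^-1.
suff <- : v * x = 1 by exact: qM.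
by apply: functional_extensionality_dep => i; apply: mulVf; apply/eqP/Zx0.
Qed.

Lemma zero_filter_zeros q x : Spec_set q x -> zero_filter q (zeros x).
Proof. by move=> qx; exists x. Qed.

(** The product of [x] with the indicator function of [zeros x] is 0, so a
    prime ideal not containing [x] contains that indicator. *)
Lemma zero_filter_setC_zeros q x :
  ~ Spec_set q x -> zero_filter q (~` zeros x).
Proof.
have [q0 _ _ _ qP] := Spec_prime q => nqx.
pose e : prodK := fun i => 1 - (x i)^-1 * x i.
exists e.
  suff /qP[] : Spec_set q (x * e) by [].
  suff -> : x * e = 0 by [].
  apply: functional_extensionality_dep => i.
  have -> : (x * e) i = x i * (1 - (x i)^-1 * x i) by [].
  have [->|xi0] := eqVneq (x i) 0; first by rewrite mul0r.
  by rewrite mulVf // subrr mulr0.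
move=> i ei0 xi0; move: ei0.
by rewrite /zeros /e /= xi0 mulr0 subr0; apply/eqP; rewrite oner_neq0.
Qed.

(** Primality is where [G] has to be maximal: in a product of fields the zero
    set of [x * y] is [zeros x `|` zeros y]. *)
Lemma ultra_ideal_prime G : UltraFilter G ->
  prime_ideal [set x : prodK | G (zeros x)].
Proof.
move=> UG; split=> /=.
- by apply: filterS filterT.
- move=> x y Gx Gy; apply: filterS (filterI Gx Gy) => i [xi yi].
  have : (x + y) i = x i + y i by [].
  by rewrite xi yi addr0.
- move=> x y; apply: filterS => i yi.
  have : (x * y) i = x i * y i by [].
  by rewrite yi mulr0.
- move=> /filter_ex[i]; apply/eqP; exact: oner_neq0.
- move=> x y Gxy.
  have [Gx|GNx] := in_ultra_setVsetC (zeros x) UG; [by left|right].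
  apply: filterS (filterI Gxy GNx) => i [/eqP].
  have -> : (x * y) i = x i * y i by [].
  by rewrite mulf_eq0 => /orP[/eqP //|/eqP].
Qed.

Definition ultra_ideal G (UG : UltraFilter G) : Spec prodK :=
  MkSpec (ultra_ideal_prime UG).

End ProductOfFields.

Lemma residue_map_eq0 (R : comPzRingType) (p : Spec R) (f : R) :
  residue_map p f = 0 <-> Spec_set p f.
Proof.
have pi0P : (\pi_({ideal_quot prime_pidealr p})%qT (f : base_ring p) == 0)
    = `[< Spec_set p f >].
  rewrite -(raddf0 (\pi_({ideal_quot prime_pidealr p})%qT)).
  by rewrite -Quotient.idealrBE subr0.
split=> [/eqP|pf].
  by rewrite tofrac_eq0 pi0P => /asboolP.
by apply/eqP; rewrite tofrac_eq0 pi0P; apply/asboolP.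
Qed.

Lemma zeros_residue_prod_map (R : comPzRingType) (E : set (Spec R)) (f : R) :
  zeros (@residue_prod_map R E f) = (\val : E -> Spec R) @^-1` Spec_V f.
Proof. by apply/seteqP; split=> e /residue_map_eq0. Qed.

Lemma Spec_eq (R : comPzRingType) (p q : Spec R) :
  Spec_set p = Spec_set q -> p = q.
Proof.
case: p q => [P pP] [Q pQ] /= PQ; case: Q / PQ pQ => pQ.
by congr MkSpec; exact: Prop_irrelevance.
Qed.

Theorem theorem3p1 (R : comPzRingType) (E : set (Spec R)) :
  @closure (PatchSpec R) E = range (Spec_map (@residue_prod_map R E)).
Proof.
apply/seteqP; split=> [p /closure_set_typeP[F PF Fp]|_ [q _ <-]].
  have [G [UG sFG]] := ultraFilterLemma PF.
  have /cvg_patchP Gp : (\val : E -> PatchSpec R) @ G --> (p : PatchSpec R).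
    by move=> B /Fp /sFG.
  exists (ultra_ideal (fun e : E => residue_field (\val e)) UG) => //.
  apply/Spec_eq/seteqP; split=> f /=; rewrite zeros_residue_prod_map => Gf.
    have [//|/(Gp f).2 GDf] := pselect (Spec_set p f).
    by have [e []] := filter_ex (filterI Gf GDf).
  exact: (Gp f).1.
apply/closure_set_typeP; have PF := zero_filter_proper q.
exists (zero_filter q) => //; apply/cvg_patchP => f; split=> qf.
  rewrite /= /fmap /= -zeros_residue_prod_map.
  exact: zero_filter_zeros.
rewrite /= /fmap /= /Spec_D -preimage_setC -zeros_residue_prod_map.
exact: zero_filter_setC_zeros.
Qed.
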